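(* Let $\mathcal A=\mathcal B\oplus\mathcal I$ be the semidirect product of a closed subalgebra $\mathcal B$ and a closed two-sided ideal $\mathcal I$ of the Banach algebra $\mathcal A$, with elements written as pairs $(b,a)$, $b\in\mathcal B$, $a\in\mathcal I$. Then $T\in LM(\mathcal A)$ if and only if there exist $R_{\mathcal I}\in Hom_{\mathcal B}(\mathcal I,\mathcal I)$, $S_{\mathcal I}\in Hom_{\mathcal B}(\mathcal B,\mathcal I)$, $T_{\mathcal B}\in LM(\mathcal B)$ and $S_{\mathcal B}\in Hom_{\mathcal B}(\mathcal I,\mathcal B)$ such that for all $a,a'\in\mathcal I$ and $b,b'\in\mathcal B$: (i) $T((b,a))=(S_{\mathcal B}(a)+T_{\mathcal B}(b),\ R_{\mathcal I}(a)+S_{\mathcal I}(b))$; (ii) $R_{\mathcal I}(aa')=aR_{\mathcal I}(a')+aS_{\mathcal B}(a')$; (iii) $R_{\mathcal I}(ab)=aS_{\mathcal I}(b)+aT_{\mathcal B}(b)$; (iv) $S_{\mathcal B}(aa')=S_{\mathcal B}(ab)=0$.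
   Context: A Banach algebra $\mathcal A$ is a semidirect product of a closed subalgebra $\mathcal B$ and a closed two-sided ideal $\mathcal I$ of $\mathcal A$ if $\mathcal A=\mathcal B\oplus\mathcal I$ (direct sum of vector spaces). Writing elements as pairs $(b,a)$ with $b\in\mathcal B$, $a\in\mathcal I$ (representing $b+a$), the product is $(b,a)(b',a')=(bb',\,aa'+ba'+ab')$ and the norm is $\|(b,a)\|=\|b\|+\|a\|$. For a Banach algebra $\mathcal C$ and Banach $\mathcal C$-bimodules $X,Y$, $Hom_{\mathcal C}(X,Y)$ is the space of bounded linear left $\mathcal C$-module maps $T:X\to Y$, i.e. $T(c\cdot x)=c\cdot T(x)$ for all $c\in\mathcal C$, $x\in X$. The left multiplier algebra is $LM(\mathcal C)=Hom_{\mathcal C}(\mathcal C,\mathcal C)$. Here $\mathcal B$ and $\mathcal I$ are $\mathcal B$-bimodules via the multiplication of $\mathcal A$. *)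

(* Defs.v *)
From HB Require Import structures.
From mathcomp Require Import all_boot all_order all_algebra.
From mathcomp Require Import all_classical all_reals.
From mathcomp Require Import topology normedtype.

Set Implicit Arguments.
Unset Strict Implicit.
Unset Printing Implicit Defensive.

Import Order.TTheory GRing.Theory Num.Theory.
Import numFieldNormedType.Exports.

Local Open Scope classical_set_scope.
Local Open Scope ring_scope.

Declare Scope banach_scope.
Delimit Scope banach_scope with B.

(* The algebras are not assumed to have a unit, so the multiplication cannot be
   the one of a MathComp ring structure. The scalars range over an arbitrary
   numFieldType, which covers both the real and the complex case. *)
HB.mixin Record CompleteNormedModule_isBanachAlgebra (K : numFieldType) A
    & CompleteNormedModule K A := {
  bmul : A -> A -> A;
  bmulA : forall x y z, bmul x (bmul y z) = bmul (bmul x y) z;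
  bmul_linearr : forall x, linear (bmul x);
  bmul_linearl : forall y, linear (bmul^~ y);
  ler_norm_bmul : forall x y, `|bmul x y| <= `|x| * `|y|
}.

#[short(type="banachAlgType")]
HB.structure Definition BanachAlgebra (K : numFieldType) :=
  {A of CompleteNormedModule K A & CompleteNormedModule_isBanachAlgebra K A}.

Infix "**" := bmul (at level 40, left associativity) : banach_scope.
Local Open Scope banach_scope.

(* A plain record rather than a packed structure on the carrier: the same space
   carries bimodule structures over several algebras. *)
Record banachBimod (K : numFieldType) (C : banachAlgType K) := BanachBimod {
  bim_sort :> completeNormedModType K;
  lact : C -> bim_sort -> bim_sort;
  ract : bim_sort -> C -> bim_sort;
  lact_linearr : forall c, linear (lact c);
  lact_linearl : forall x, linear (lact^~ x);
  ract_linearr : forall x, linear (ract x);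
  ract_linearl : forall c, linear (ract^~ c);
  lactA : forall c d x, lact c (lact d x) = lact (c ** d) x;
  ractA : forall x c d, ract (ract x c) d = ract x (c ** d);
  lract : forall c x d, ract (lact c x) d = lact c (ract x d);
  lact_bounded : exists M : K, forall c x, `|lact c x| <= M * `|c| * `|x|;
  ract_bounded : exists M : K, forall x c, `|ract x c| <= M * `|x| * `|c|
}.

Section BoundedHom.
Variables (K : numFieldType) (C : banachAlgType K).

Definition bHom (X Y : banachBimod C) : set (X -> Y) :=
  [set T | [/\ linear T,
               exists M : K, forall x, `|T x| <= M * `|x| &
               forall c x, T (lact c x) = lact c (T x)]].

Arguments bHom : clear implicits.

Lemma bmul_bounded : exists M : K, forall x y : C, `|x ** y| <= M * `|x| * `|y|.
Proof. by exists 1 => x y; rewrite mul1r ler_norm_bmul. Qed.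

Definition regular_bimod : banachBimod C :=
  @BanachBimod K C C (@bmul K C) (@bmul K C)
    (@bmul_linearr K C) (@bmul_linearl K C)
    (@bmul_linearr K C) (@bmul_linearl K C)
    (@bmulA K C) (fun x c d => esym (bmulA x c d))
    (fun c x d => esym (bmulA c x d)) bmul_bounded bmul_bounded.

Definition LM : set (C -> C) := bHom regular_bimod regular_bimod.

End BoundedHom.
Arguments bHom {K C} X Y T.
Arguments regular_bimod {K} C.
Arguments LM {K} C T.

Section ClosedSubalgebra.
Variables (K : numFieldType) (A : banachAlgType K).

Record closedSubalg := ClosedSubalg {
  sa_set :> A -> Prop;
  sa_closed : closed (sa_set : set A);
  sa0 : sa_set 0;
  sa_lin : forall (k : K) x y, sa_set x -> sa_set y -> sa_set (k *: x + y);
  sa_mul : forall x y, sa_set x -> sa_set y -> sa_set (x ** y)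
}.

Record closedIdeal := ClosedIdeal {
  id_subalg :> closedSubalg;
  id_mull : forall x y, id_subalg y -> id_subalg (x ** y);
  id_mulr : forall x y, id_subalg x -> id_subalg (x ** y)
}.

End ClosedSubalgebra.

Section SubAlgebra.
Variables (K : numFieldType) (A : banachAlgType K) (B : closedSubalg A).

Definition sa_pred : {pred A} := fun x => `[< B x >].

Inductive sub_alg : Type := SubAlg x & x \in sa_pred.
Definition sa_val (w : sub_alg) : A := let: SubAlg x _ := w in x.

Lemma sa_predP x : reflect (B x) (x \in sa_pred).
Proof. exact: asboolP. Qed.

Lemma sa_submod_closed : submod_closed sa_pred.
Proof.
split; first by apply/sa_predP; exact: sa0.
by move=> k x y /sa_predP Bx /sa_predP By; apply/sa_predP; exact: sa_lin.
Qed.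

HB.instance Definition _ := GRing.isSubmodClosed.Build K A sa_pred
  sa_submod_closed.

HB.instance Definition _ := [isSub of sub_alg for sa_val].
HB.instance Definition _ := [Choice of sub_alg by <:].
HB.instance Definition _ := [SubChoice_isSubLmodule of sub_alg by <:].

Let sa_norm (x : sub_alg) : K := `|sa_val x|.

Let sa_normD x y : sa_norm (x + y) <= sa_norm x + sa_norm y.
Proof. exact: ler_normD. Qed.

Let sa_normZ k x : sa_norm (k *: x) = `|k| * sa_norm x.
Proof. exact: normrZ. Qed.

Let sa_norm_eq0 x : sa_norm x = 0 -> x = 0.
Proof. by move=> /normr0_eq0 x0; exact: val_inj. Qed.

HB.instance Definition _ := Lmodule_isNormed.Build K sub_alg
  sa_normD sa_normZ sa_norm_eq0.

Lemma sa_normE (x : sub_alg) : `|x| = `|sa_val x|. Proof. by []. Qed.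

Lemma sa_valP (x : sub_alg) : B (sa_val x).
Proof. by case: x => x Bx; exact/sa_predP. Qed.

Definition sa_sub (x : A) (Bx : B x) : sub_alg :=
  SubAlg (introT (sa_predP x) Bx).

Let sa_cauchy_cvg (F : set_system sub_alg) :
  ProperFilter F -> cauchy F -> cvg F.
Proof.
move=> FF /cauchy_ballP cF.
have cG : cauchy (sa_val @ F).
  apply/cauchy_ballP => e e0; have := cF e e0.
  rewrite !near_simpl => -[[P Q] [/= FP FQ] PQ].
  exists (sa_val @` P, sa_val @` Q) => /=.
    by split; [apply: filterS FP|apply: filterS FQ] => z ?; exists z.
  move=> -[x y] /= [[u Pu <-] [v Qv <-]].
  by have /= := PQ (u, v) (conj Pu Qv); rewrite -!ball_normE.
have cvG : cvg (sa_val @ F) by apply: cauchy_cvg; exact: cG.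
move: cvG => /cvg_ex[l Fl].
have Bl : B l.
  apply: (closed_cvg (B : A -> Prop) (@sa_closed _ _ B) _ l Fl).
  by apply: nearW => x; exact: sa_valP.
apply/cvg_ex; exists (sa_sub Bl); apply/cvgrPdist_lt => e e0.
by move/cvgrPdist_lt : Fl => /(_ e e0).
Qed.

HB.instance Definition _ := Uniform_isComplete.Build sub_alg sa_cauchy_cvg.

Definition sa_bmul (x y : sub_alg) : sub_alg :=
  sa_sub (sa_mul (sa_valP x) (sa_valP y)).

Let sa_bmulA x y z : sa_bmul x (sa_bmul y z) = sa_bmul (sa_bmul x y) z.
Proof. by apply: val_inj; exact: bmulA. Qed.

Let sa_bmul_linearr x : linear (sa_bmul x).
Proof. by move=> k y z; apply: val_inj; exact: bmul_linearr. Qed.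

Let sa_bmul_linearl y : linear (sa_bmul^~ y).
Proof. by move=> k x z; apply: val_inj; exact: bmul_linearl. Qed.

Let sa_norm_bmul x y : `|sa_bmul x y| <= `|x| * `|y|.
Proof. exact: ler_norm_bmul. Qed.

HB.instance Definition _ := CompleteNormedModule_isBanachAlgebra.Build K sub_alg
  sa_bmulA sa_bmul_linearr sa_bmul_linearl sa_norm_bmul.

End SubAlgebra.

Coercion sub_alg : closedSubalg >-> Sortclass.
Coercion sa_val : sub_alg >-> BanachAlgebra.sort.

Section IdealBimodule.
Variables (K : numFieldType) (A : banachAlgType K).
Variables (B : closedSubalg A) (I : closedIdeal A).

Definition id_lact (b : B) (a : I) : I := sa_sub (id_mull (sa_val b) (sa_valP a)).

Definition id_ract (a : I) (b : B) : I := sa_sub (id_mulr (sa_val b) (sa_valP a)).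

Let id_lact_linearr b : linear (id_lact b).
Proof. by move=> k x y; apply: val_inj; exact: bmul_linearr. Qed.

Let id_lact_linearl a : linear (id_lact^~ a).
Proof. by move=> k x y; apply: val_inj; exact: bmul_linearl. Qed.

Let id_ract_linearr a : linear (id_ract a).
Proof. by move=> k x y; apply: val_inj; exact: bmul_linearr. Qed.

Let id_ract_linearl b : linear (id_ract^~ b).
Proof. by move=> k x y; apply: val_inj; exact: bmul_linearl. Qed.

Let id_lactA c d a : id_lact c (id_lact d a) = id_lact (c ** d) a.
Proof. by apply: val_inj; exact: bmulA. Qed.

Let id_ractA a c d : id_ract (id_ract a c) d = id_ract a (c ** d).
Proof. by apply: val_inj; rewrite /= bmulA. Qed.

Let id_lract c a d : id_ract (id_lact c a) d = id_lact c (id_ract a d).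
Proof. by apply: val_inj; rewrite /= bmulA. Qed.

Let id_lact_bounded :
  exists M : K, forall b a, `|id_lact b a| <= M * `|b| * `|a|.
Proof. by exists 1 => b a; rewrite mul1r; exact: ler_norm_bmul. Qed.

Let id_ract_bounded :
  exists M : K, forall a b, `|id_ract a b| <= M * `|a| * `|b|.
Proof. by exists 1 => a b; rewrite mul1r; exact: ler_norm_bmul. Qed.

Definition ideal_bimod : banachBimod B :=
  @BanachBimod K B I id_lact id_ract
    id_lact_linearr id_lact_linearl id_ract_linearr id_ract_linearl
    id_lactA id_ractA id_lract id_lact_bounded id_ract_bounded.

(* The element written (b, a). *)
Definition sdpair (b : B) (a : I) : A := (b : A) + (a : A).

Record semidirect : Prop := Semidirect {
  semidirect_add : forall x : A, exists (b : B) (a : I), x = sdpair b a;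
  semidirect_cap : forall x : A, B x -> I x -> x = 0;
  semidirect_norm : forall (b : B) (a : I), `|sdpair b a| = `|b| + `|a|
}.

End IdealBimodule.

Infix "<*" := id_ract (at level 40, left associativity) : banach_scope.

Lemma sdpairM (K : numFieldType) (A : banachAlgType K)
    (B : closedSubalg A) (I : closedIdeal A) (b b' : B) (a a' : I) :
  sdpair b a ** sdpair b' a' =
  sdpair (b ** b') (a ** a' + id_lact b a' + a <* b').
Proof.
have mulDr (x y z : A) : x ** (y + z) = x ** y + x ** z.
  by have := bmul_linearr x 1 y z; rewrite !scale1r.
have mulDl (x y z : A) : (y + z) ** x = y ** x + z ** x.
  by have := bmul_linearl x 1 y z; rewrite !scale1r.
rewrite /sdpair /= !mulDl !mulDr -!addrA; congr (_ + _).
by rewrite [LHS]addrA [LHS]addrC.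
Qed.

(* Main.v *)
Require Import Defs.
From mathcomp Require Import all_boot all_order all_algebra.
From mathcomp Require Import all_classical all_reals topology normedtype.

(** The decomposition [A = B (+) I] turns an operator [T] on [A] into a two by
two matrix of operators between [B] and [I], whose corners are obtained by
compressing [T]: include a summand into [A], apply [T], project to a summand.
Inclusions and projections are contractions that commute with left
multiplication by [B], so the corners of a left multiplier are bounded left
[B]-module maps ([bHom_compress]).

What is left of multiplicativity is the action of [I].  As [I] is an ideal,
[a ** T x] lies in [I], with coordinates
[(0, a ** sdI (T x) + a <* sdB (T x))] ([sdB_mulI], [sdI_mulI]); comparing them
with the coordinates of [T (a ** x)] for [x] in [I] and for [x] in [B] yields
the formulas for [R_I] and the vanishing of [S_B] on [I ** A].

Conversely, a matrix of bounded [B]-linear maps is bounded because the norm of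
[A] is the sum of the norms of the coordinates, and the product formula [sdpairM]
splits [T (x ** y) = x ** T y] into coordinates where each term is matched
by [B]-linearity or by one of those identities ([assembly_mul]). *)

Set Implicit Arguments.
Unset Strict Implicit.
Unset Printing Implicit Defensive.

Import Order.TTheory GRing.Theory Num.Theory.

Local Open Scope ring_scope.
Local Open Scope banach_scope.

(** * Linear maps given as bare functions *)

Section LinearFun.
Variables (K : numFieldType) (U V : lmodType K) (f : U -> V).
Hypothesis f_lin : linear f.

Lemma linear_funD x y : f (x + y) = f x + f y.
Proof. by have := f_lin 1 x y; rewrite !scale1r. Qed.

End LinearFun.

(** The constant in [bHom] is an arbitrary scalar, not constrained at all when
the source is the zero space; replaced by its norm, it can be added to others and
composed with contractions.  The norm works because [M * x], being above [u],
is nonnegative and hence its own norm. *)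
Lemma ler_mul_normr (K : numFieldType) (u M x : K) :
  0 <= u -> 0 <= x -> u <= M * x -> u <= `|M| * x.
Proof.
move=> u0 x0 uMx; rewrite -[x in `|M| * x]ger0_norm // -normrM ger0_norm //.
exact: le_trans u0 uMx.
Qed.

Lemma bmulDr (K : numFieldType) (C : banachAlgType K) (x y z : C) :
  x ** (y + z) = x ** y + x ** z.
Proof. exact: linear_funD (@bmul_linearr K C x) _ _. Qed.

(** * Compressions of left multipliers *)

(** All four corners of the matrix of [T] are instances: [j] is then the
inclusion of [B] or [I], and [p] the projection to one of them. *)
Lemma bHom_compress (K : numFieldType) (A : banachAlgType K)
    (B : closedSubalg A) (X Y : banachBimod B) (j : X -> A) (p : A -> Y)
    (T : A -> A) :
  linear j -> (forall x, `|j x| <= `|x|) ->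
  (forall (b : B) x, j (lact b x) = (b : A) ** j x) ->
  linear p -> (forall x, `|p x| <= `|x|) ->
  (forall (b : B) x, p ((b : A) ** x) = lact b (p x)) ->
  LM A T -> bHom X Y (p \o T \o j).
Proof.
move=> jl jn jb pl pn pb [Tl [M TM] Tb]; split.
- by move=> k x y /=; rewrite jl Tl pl.
- exists `|M| => x /=; apply: (le_trans (pn _)).
  apply: (le_trans (ler_mul_normr (normr_ge0 _) (normr_ge0 _) (TM _))).
  by apply: ler_wpM2l => //; exact: jn.
- by move=> b x /=; rewrite jb [T _]Tb pb.
Qed.

(** * Coordinates in a semidirect product *)

Section Coordinates.
Variables (K : numFieldType) (A : banachAlgType K).
Variables (B : closedSubalg A) (I : closedIdeal A).
Hypothesis hA : semidirect B I.

Lemma sdpair_linear (k : K) (b b' : B) (a a' : I) :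
  sdpair (k *: b + b') (k *: a + a') = k *: sdpair b a + sdpair b' a'.
Proof. by rewrite /sdpair /= scalerDr addrACA. Qed.

Lemma sdpair0a (a : I) : sdpair (0 : B) a = a.
Proof. by rewrite /sdpair /= add0r. Qed.

Lemma id_lactDr (b : B) (x y : I) :
  id_lact b (x + y) = id_lact b x + id_lact b y.
Proof. by apply: val_inj; exact: bmulDr. Qed.

Lemma id_ractDr (a : I) (x y : B) : a <* (x + y) = a <* x + a <* y.
Proof. by apply: val_inj; exact: bmulDr. Qed.

Lemma sdpair_inj (b b' : B) (a a' : I) :
  sdpair b a = sdpair b' a' -> b = b' /\ a = a'.
Proof.
(* Additivity of the norm makes a difference of norm zero vanish in both
   coordinates. *)
move=> e.
have e0 : `|b - b'| + `|a - a'| = 0.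
  rewrite -(semidirect_norm hA).
  have -> : sdpair (b - b') (a - a') = sdpair b a - sdpair b' a'.
    by rewrite /sdpair /= opprD addrACA.
  by rewrite e subrr normr0.
move/eqP: e0; rewrite paddr_eq0 // !normr_eq0 !subr_eq0.
by case/andP=> /eqP -> /eqP ->.
Qed.

Lemma sdcoord_subproof (x : A) : exists p : B * I, x = sdpair p.1 p.2.
Proof. by have [b [a ->]] := semidirect_add hA x; exists (b, a). Qed.

Definition sdcoord (x : A) : B * I := projT1 (cid (sdcoord_subproof x)).
Definition sdB (x : A) : B := (sdcoord x).1.
Definition sdI (x : A) : I := (sdcoord x).2.

Lemma sdcoordE (x : A) : x = sdpair (sdB x) (sdI x).
Proof. exact: projT2 (cid (sdcoord_subproof x)). Qed.

Lemma sdB_pair (b : B) (a : I) : sdB (sdpair b a) = b.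
Proof. by have [] := sdpair_inj (sdcoordE (sdpair b a)). Qed.

Lemma sdI_pair (b : B) (a : I) : sdI (sdpair b a) = a.
Proof. by have [] := sdpair_inj (sdcoordE (sdpair b a)). Qed.

Lemma sdB_linear : linear sdB.
Proof.
move=> k x y; rewrite {1}(sdcoordE x) {1}(sdcoordE y).
by rewrite -sdpair_linear sdB_pair.
Qed.

Lemma sdI_linear : linear sdI.
Proof.
move=> k x y; rewrite {1}(sdcoordE x) {1}(sdcoordE y).
by rewrite -sdpair_linear sdI_pair.
Qed.

Lemma ler_norm_sdB x : `|sdB x| <= `|x|.
Proof. by rewrite {2}(sdcoordE x) (semidirect_norm hA) lerDl. Qed.

Lemma ler_norm_sdI x : `|sdI x| <= `|x|.
Proof. by rewrite {2}(sdcoordE x) (semidirect_norm hA) lerDr. Qed.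

Lemma mulB_pair (b b' : B) (a : I) :
  (b : A) ** sdpair b' a = sdpair (b ** b') (id_lact b a).
Proof. by rewrite bmulDr. Qed.

Lemma mulI_pair (a a' : I) (b : B) :
  (a : A) ** sdpair b a' = sdpair (0 : B) (a ** a' + a <* b).
Proof. by rewrite sdpair0a bmulDr addrC. Qed.

(** [sdB] and [sdI] commute with left multiplication by [B] since both summands
are stable under it. *)
Lemma sdB_mulB (b : B) x : sdB ((b : A) ** x) = b ** sdB x.
Proof. by rewrite {1}(sdcoordE x) mulB_pair sdB_pair. Qed.

Lemma sdI_mulB (b : B) x : sdI ((b : A) ** x) = id_lact b (sdI x).
Proof. by rewrite {1}(sdcoordE x) mulB_pair sdI_pair. Qed.

(** A left multiplication by [I] mixes both coordinates into the second, which
is the source of the terms pairing [R_I] with [S_B] and [S_I] with [T_B]. *)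
Lemma sdB_mulI (a : I) x : sdB ((a : A) ** x) = 0.
Proof. by rewrite (sdcoordE x) mulI_pair sdB_pair. Qed.

Lemma sdI_mulI (a : I) x : sdI ((a : A) ** x) = a ** sdI x + a <* sdB x.
Proof. by rewrite {1}(sdcoordE x) mulI_pair sdI_pair. Qed.

End Coordinates.

(** * The matrix of a left multiplier *)

Section Matrix.
Variables (K : numFieldType) (A : banachAlgType K).
Variables (B : closedSubalg A) (I : closedIdeal A).
Hypothesis hA : semidirect B I.

Section Corners.
Variable T : A -> A.
Hypothesis hT : LM A T.

Lemma bHom_cornerII :
  bHom (ideal_bimod B I) (ideal_bimod B I) (fun a : I => sdI hA (T a)).
Proof.
exact: (bHom_compress (X := ideal_bimod B I) (Y := ideal_bimod B I)
  (j := fun a : I => a : A) _ _ _ (sdI_linear hA) (ler_norm_sdI hA)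
  (sdI_mulB hA) hT).
Qed.

Lemma bHom_cornerBI :
  bHom (regular_bimod B) (ideal_bimod B I) (fun b : B => sdI hA (T b)).
Proof.
exact: (bHom_compress (X := regular_bimod B) (Y := ideal_bimod B I)
  (j := fun b : B => b : A) _ _ _ (sdI_linear hA) (ler_norm_sdI hA)
  (sdI_mulB hA) hT).
Qed.

Lemma bHom_cornerBB : LM B (fun b : B => sdB hA (T b)).
Proof.
exact: (bHom_compress (X := regular_bimod B) (Y := regular_bimod B)
  (j := fun b : B => b : A) _ _ _ (sdB_linear hA) (ler_norm_sdB hA)
  (sdB_mulB hA) hT).
Qed.

Lemma bHom_cornerIB :
  bHom (ideal_bimod B I) (regular_bimod B) (fun a : I => sdB hA (T a)).
Proof.
exact: (bHom_compress (X := ideal_bimod B I) (Y := regular_bimod B)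
  (j := fun a : I => a : A) _ _ _ (sdB_linear hA) (ler_norm_sdB hA)
  (sdB_mulB hA) hT).
Qed.

(** The corners recover [T], because [(b, a)] is the sum of the included [b] and
[a]. *)
Lemma LM_cornerE (b : B) (a : I) :
  T (sdpair b a) = sdpair (sdB hA (T a) + sdB hA (T b))
                          (sdI hA (T a) + sdI hA (T b)).
Proof.
case: hT => Tlin _ _; rewrite /sdpair addrC (linear_funD Tlin).
rewrite [LHS](sdcoordE hA).
by rewrite (linear_funD (sdB_linear hA)) (linear_funD (sdI_linear hA)).
Qed.

Lemma LM_mul (x y : A) : T (x ** y) = x ** T y.
Proof. by case: hT => _ _; apply. Qed.

End Corners.

Section Assembly.
Variables (T : A -> A).
Variables (R_I : I -> I) (S_I : B -> I) (T_B : B -> B) (S_B : I -> B).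
Hypothesis R_hom : bHom (ideal_bimod B I) (ideal_bimod B I) R_I.
Hypothesis SI_hom : bHom (regular_bimod B) (ideal_bimod B I) S_I.
Hypothesis TB_hom : LM B T_B.
Hypothesis SB_hom : bHom (ideal_bimod B I) (regular_bimod B) S_B.
Hypothesis TE : forall (b : B) (a : I),
  T (sdpair b a) = sdpair (S_B a + T_B b) (R_I a + S_I b).

Lemma assembly_linear : linear T.
Proof.
move: R_hom SI_hom TB_hom SB_hom => [Rl _ _] [SIl _ _] [TBl _ _] [SBl _ _].
move=> k x y; rewrite (sdcoordE hA x) (sdcoordE hA y) -sdpair_linear !TE.
rewrite -sdpair_linear [S_B _]SBl [T_B _]TBl [R_I _]Rl [S_I _]SIl.
by rewrite !scalerDr [X in sdpair X _]addrACA [X in sdpair _ X]addrACA.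
Qed.

(** Each column of the matrix is bounded by the sum of its two constants; the
total of all four serves for both columns. *)
Lemma assembly_bounded : exists M : K, forall x, `|T x| <= M * `|x|.
Proof.
move: R_hom SI_hom TB_hom SB_hom.
move=> [_ [MR hR] _] [_ [MSI hSI] _] [_ [MTB hTB] _] [_ [MSB hSB] _].
exists ((`|MSB| + `|MR|) + (`|MTB| + `|MSI|)) => x.
rewrite (sdcoordE hA x) TE !(semidirect_norm hA).
set b := sdB hA x; set a := sdI hA x.
have : `|S_B a| + `|T_B b| + (`|R_I a| + `|S_I b|) <=
       (`|MSB| + `|MR|) * `|a| + (`|MTB| + `|MSI|) * `|b|.
  rewrite addrACA !mulrDl.
  by apply: lerD; apply: lerD; apply: ler_mul_normr.
move=> h; apply: (le_trans (lerD (ler_normD _ _) (ler_normD _ _))).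
apply: (le_trans h); rewrite mulrDr addrC lerD // ler_wpM2r //.
  by rewrite lerDr addr_ge0.
by rewrite lerDl addr_ge0.
Qed.

Hypothesis R_mulI : forall a a' : I, R_I (a ** a') = a ** R_I a' + a <* S_B a'.
Hypothesis R_mulB : forall (a : I) (b : B),
  R_I (a <* b) = a ** S_I b + a <* T_B b.
Hypothesis SB_mulI : forall a a' : I, S_B (a ** a') = 0.
Hypothesis SB_mulB : forall (a : I) (b : B), S_B (a <* b) = 0.

(** On the [B]-coordinate of a product, [S_B] kills the two terms in which the
left factor is [a]; on the [I]-coordinate, the terms in [a] are expanded by the
formulas for [R_I] and those in [b] by [B]-linearity. *)
Lemma assembly_mul x y : T (x ** y) = x ** T y.
Proof.
move: R_hom SI_hom TB_hom SB_hom => [Rl _ Rb] [SIl _ SIb].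
move=> [TBl _ TBb] [SBl _ SBb].
rewrite (sdcoordE hA x) (sdcoordE hA y).
move: (sdB hA x) (sdI hA x) (sdB hA y) (sdI hA y) => b a b' a'.
rewrite sdpairM !TE sdpairM; congr sdpair.
  rewrite !(linear_funD SBl) SB_mulI SB_mulB add0r addr0 bmulDr.
  by rewrite [S_B _]SBb [T_B _]TBb.
rewrite !(linear_funD Rl) R_mulI R_mulB.
rewrite [R_I (id_lact _ _)]Rb [S_I (_ ** _)]SIb /=.
rewrite bmulDr id_lactDr id_ractDr.
by rewrite [LHS](+%R.[AC (3*2*1) ((1*4)*(3*6)*(2*5))]).
Qed.

End Assembly.

End Matrix.

Theorem lemma2p1 (K : numFieldType) (A : banachAlgType K)
    (B : closedSubalg A) (I : closedIdeal A) (hA : semidirect B I)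
    (T : A -> A) :
  LM A T <->
  exists (R_I : I -> I) (S_I : B -> I) (T_B : B -> B) (S_B : I -> B),
    [/\ bHom (ideal_bimod B I) (ideal_bimod B I) R_I,
        bHom (regular_bimod B) (ideal_bimod B I) S_I,
        LM B T_B &
        bHom (ideal_bimod B I) (regular_bimod B) S_B] /\
    forall (a a' : I) (b b' : B),
      [/\ T (sdpair b a) = sdpair (S_B a + T_B b) (R_I a + S_I b),
          R_I (a ** a') = a ** R_I a' + a <* S_B a',
          R_I (a <* b) = a ** S_I b + a <* T_B b &
          S_B (a ** a') = 0 /\ S_B (a <* b) = 0].
Proof.
split=> [hT|[R_I [S_I [T_B [S_B [[RH SIH TBH SBH] H]]]]]].
  exists (fun a => sdI hA (T a)), (fun b => sdI hA (T b)),
    (fun b => sdB hA (T b)), (fun a => sdB hA (T a)); split.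
    split; [exact: bHom_cornerII|exact: bHom_cornerBI|exact: bHom_cornerBB|].
    exact: bHom_cornerIB.
  move=> a a' b _; split.
  - exact: LM_cornerE.
  - by rewrite (LM_mul hT a a') sdI_mulI.
  - by rewrite (LM_mul hT a b) sdI_mulI.
  - by rewrite (LM_mul hT a a') (LM_mul hT a b) !sdB_mulI.
have TE b a := let: And4 h _ _ _ := H a 0 b 0 in h.
split.
- exact (assembly_linear hA RH SIH TBH SBH TE).
- exact (assembly_bounded hA RH SIH TBH SBH TE).
- move=> x y; apply: (assembly_mul hA RH SIH TBH SBH TE).
  + by move=> a a'; have [] := H a a' 0 0.
  + by move=> a b; have [] := H a 0 b 0.
  + by move=> a a'; have [_ _ _ []] := H a a' 0 0.
  + by move=> a b; have [_ _ _ []] := H a 0 b 0.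
Qed.
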